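(* Let $n>m\ge 2$ be integers. a) An integer partition in $\mathcal{P}(n,m)$ is 3-minimal if it is of the form \[ 1^{m-1}(n-m+1)^1 . \] b) An integer partition in $\mathcal{P}(n,m)$ is 3-maximal if it is of the form \[ q^{m-r}(q+1)^r,\quad\text{where } n=qm+r,\ 0\le r<m . \]
   Context: $\mathcal{P}(n,m)$ is the set of all integer partitions $\boldsymbol{a}=(a_1,\dots,a_m)$ of $n$ into $m$ parts, i.e. $a_1,\dots,a_m$ are positive integers with $a_1+\dots+a_m=n$. The order of the parts is irrelevant. The notation $1^{\lambda_1}2^{\lambda_2}\cdots n^{\lambda_n}$ (items $i^0$ omitted) denotes the partition having exactly $\lambda_i$ parts equal to $i$. Let $w_3(0)=0$ and $w_3(k)=\frac{1}{\binom{n}{k}k}$ for $k\in\{1,\dots,n\}$, and let \[ F_{w_3}(a)=\sum_{k=0}^n\left(\binom{n-a}{k}+\binom{n-a}{k-a}\right)w_3(k), \] where $\binom{N}{k}=0$ if $k<0$ or $k>N$. A partition $\boldsymbol{a}\in\mathcal{P}(n,m)$ is called 3-minimal (resp. 3-maximal) if $\sum_{i=1}^m a_iF_{w_3}(a_i)$ attains at $\boldsymbol{a}$ its minimum (resp. maximum) over $\mathcal{P}(n,m)$. *)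

(* Defs.v *)
From mathcomp Require Import all_boot all_order all_algebra.

Set Implicit Arguments.
Unset Strict Implicit.
Unset Printing Implicit Defensive.

Import Order.TTheory GRing.Theory Num.Theory.
Local Open Scope ring_scope.

(* P(n, m).  The parts are listed in an arbitrary order: two lists represent
   the same partition iff they are related by perm_eq. *)
Definition int_partition (n m : nat) : pred (seq nat) :=
  fun a => [&& size a == m, all (fun x => 0 < x)%N a & sumn a == n].

(* The partition is v_1^{l_1} v_2^{l_2} ... for t = [:: (v_1, l_1); ...];
   pairs (v, 0) contribute no parts. *)
Definition of_form (a : seq nat) (t : seq (nat * nat)) : bool :=
  perm_eq a (tally_seq t).

Definition w3 (n k : nat) : rat :=
  if k == 0%N then 0 else (('C(n, k) * k)%N%:R)^-1.

(* binom(N, k - a), which is 0 when k - a is negative; the test is needed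
   because subtraction on nat is truncated. *)
Definition bin_shift (N k a : nat) : nat :=
  if (a <= k)%N then 'C(N, k - a) else 0%N.

Definition F3 (n a : nat) : rat :=
  \sum_(0 <= k < n.+1) ('C(n - a, k) + bin_shift (n - a) k a)%N%:R * w3 n k.

Definition cost3 (n : nat) (a : seq nat) : rat :=
  \sum_(x <- a) x%:R * F3 n x.

Definition minimal3 (n m : nat) (a : seq nat) : Prop :=
  int_partition n m a /\
  forall b : seq nat, int_partition n m b -> cost3 n a <= cost3 n b.

Definition maximal3 (n m : nat) (a : seq nat) : Prop :=
  int_partition n m a /\
  forall b : seq nat, int_partition n m b -> cost3 n b <= cost3 n a.

(* Main.v *)
(** Writing [h] for the harmonic numbers, [F3 n a = h n - h a + a^-1] for
    [1 <= a <= n], so that [a * F3 n a = a * (h n - h a) + 1] has increments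
    [h n - h a - 1] and is strictly concave in [a].  All partitions in
    [P(n, m)] have the same length and sum, hence give the same value to an
    affine function: the tangent of the concave function at [q] bounds the cost
    from above, its chord over [1, n - m + 1] bounds the cost from below, and
    the parts of the two extremal partitions lie where these lines touch it. *)
Require Import Defs.
From mathcomp Require Import all_boot all_order all_algebra.
From mathcomp Require Import zify ring lra.

Set Implicit Arguments.
Unset Strict Implicit.
Unset Printing Implicit Defensive.

Import Order.TTheory GRing.Theory Num.Theory.
Local Open Scope ring_scope.

(** Both sides count ordered pairs of disjoint subsets of sizes [a] and [b]. They vanish when
    [a + b > n]; otherwise both equal the same quotient of factorials. *)
Lemma mul_bin_swap (n a b : nat) :
  ('C(n, a) * 'C(n - a, b) = 'C(n, b) * 'C(n - b, a))%N.
Proof.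
have [le_abn | lt_nab] := leqP (a + b) n; last first.
  have Z c d : (n < c + d)%N -> ('C(n, c) * 'C(n - c, d) = 0)%N.
    have [/bin_small-> // | le_cn lt_n] := ltnP n c.
    by rewrite (@bin_small (n - c)) ?muln0 //; lia.
  by rewrite !Z // addnC.
have H c d : (c + d <= n)%N ->
    ('C(n, c) * 'C(n - c, d) * (c`! * d`! * (n - c - d)`!) = n`!)%N.
  move=> le_cdn; have /bin_fact <- : (c <= n)%N by lia.
  have /bin_fact <- : (d <= n - c)%N by lia.
  by ring.
apply/eqP; rewrite -(@eqn_pmul2r (a`! * b`! * (n - a - b)`!)); last first.
  by rewrite !muln_gt0 !fact_gt0.
by rewrite H // -subnDA addnC (mulnC a`!) subnDA H // addnC.
Qed.

(** Chains of an [a]-set inside a [k]-set; taking complements reduces this to [mul_bin_swap]. *)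
Lemma mul_bin_chain (n k a : nat) : (a <= k <= n)%N ->
  ('C(n, a) * 'C(n - a, k - a) = 'C(n, k) * 'C(k, a))%N.
Proof.
move=> /andP[le_ak le_kn].
rewrite -(@bin_sub (n - a)) ?leq_sub2r // -(bin_sub le_kn).
have -> : (n - a - (k - a) = n - k)%N by lia.
by rewrite mul_bin_swap subKn.
Qed.

Lemma sum_bin_col (n a : nat) : (\sum_(k < n) 'C(k, a) = 'C(n, a.+1))%N.
Proof.
by elim: n => [|n IHn]; rewrite ?big_ord0 // big_ord_recr /= IHn binS.
Qed.

Definition harm (n : nat) : rat := \sum_(i < n) (i.+1%:R)^-1.

Lemma harmS (n : nat) : harm n.+1 = harm n + (n.+1%:R)^-1.
Proof. exact: big_ord_recr. Qed.

Lemma w3_succ (n k : nat) : w3 n.+1 k.+1 = (n.+1%:R * 'C(n, k)%:R)^-1.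
Proof. by rewrite /w3 /= mulnC -mul_bin_diag natrM. Qed.

(** By [mul_bin_chain] each term is ['C(k, a)] over a denominator independent of [k], so the
    hockey-stick identity [sum_bin_col] evaluates the sum. *)
Lemma sum_w3_up (n a : nat) : (a <= n)%N ->
  \sum_(k < n.+1) (bin_shift (n.+1 - a.+1) k.+1 a.+1)%:R * w3 n.+1 k.+1
    = (a.+1%:R)^-1.
Proof.
move=> le_an.
have Cna0 : 'C(n, a)%:R != 0 :> rat by rewrite pnatr_eq0 -lt0n bin_gt0.
have n0 : n.+1%:R != 0 :> rat by rewrite pnatr_eq0.
have a0 : a.+1%:R != 0 :> rat by rewrite pnatr_eq0.
transitivity (\sum_(k < n.+1) 'C(k, a)%:R * (n.+1%:R * 'C(n, a)%:R : rat)^-1).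
  apply: eq_bigr => k _; rewrite w3_succ /bin_shift ltnS !subSS.
  have le_kn : (k <= n)%N by rewrite -ltnS.
  have [le_ak | /bin_small->] := leqP a k; last by rewrite !mul0r.
  have Cnk0 : 'C(n, k)%:R != 0 :> rat by rewrite pnatr_eq0 -lt0n bin_gt0.
  have /(congr1 (fun x => x%:R : rat)) : ('C(n, a) * 'C(n - a, k - a) =
    'C(n, k) * 'C(k, a))%N by rewrite mul_bin_chain // le_ak.
  rewrite !natrM => E; apply/eqP.
  rewrite eqr_div ?mulf_neq0 //; apply/eqP.
  by rewrite mulrCA [X in _ * X]mulrC E; ring.
rewrite -mulr_suml -natr_sum sum_bin_col.
have /(congr1 (fun x => x%:R : rat)) := mul_bin_diag n.+1 a.
rewrite !natrM => ->; field.
by rewrite nat1r a0 pnatr_eq0 -lt0n bin_gt0 ltnS le_an.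
Qed.

(** The reflection of [k] to [n - k] preserves the weight, which depends on [k] only through
    ['C(n, k)], and turns this sum into that of [sum_w3_up]. *)
Lemma sum_w3_down (n a : nat) : (a <= n)%N ->
  \sum_(k < n.+1) 'C(n - a, k)%:R * w3 n.+1 k.+1 = (a.+1%:R)^-1.
Proof.
move=> le_an; rewrite -(sum_w3_up le_an) (reindex_inj rev_ord_inj) /=.
apply: eq_bigr => k _; rewrite !w3_succ /bin_shift ltnS !subSS.
have le_kn : (k <= n)%N by rewrite -ltnS.
rewrite bin_sub //; congr (_%:R * _).
have [le_ak | lt_ka] := leqP a k; last by rewrite bin_small //; lia.
rewrite -(@bin_sub (n - a) (k - a)); last by lia.
by congr 'C(_, _); lia.
Qed.

(** The shifted binomials contribute [a^-1]. The unshifted ones form a sum [S a] that telescopes: by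
    Pascal's rule, [S b - S b.+1] is the sum of [sum_w3_down]. *)
Lemma F3E (n a : nat) : (0 < a <= n)%N ->
  F3 n a = harm n - harm a + (a%:R)^-1.
Proof.
case: n => [|n]; first by case: a.
case: a => [|a] //; rewrite ltnS /= => le_an.
rewrite /F3 big_mkord big_ord_recl /= {1}/w3 /= mulr0 add0r.
under eq_bigr do rewrite natrD mulrDl.
rewrite big_split /= sum_w3_up //; congr (_ + _).
pose S b := \sum_(k < n.+1) 'C(n.+1 - b, k.+1)%:R * w3 n.+1 k.+1.
have S_step b : (b <= n)%N -> S b = S b.+1 + (b.+1%:R)^-1.
  move=> le_bn; rewrite -(sum_w3_down le_bn) -big_split /=.
  apply: eq_bigr => k _; rewrite -mulrDl -natrD subSS.
  by rewrite subSn // binS.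
(* Descending induction from [b = n.+1], where [S b = 0] since every ['C(0, k.+1)] is 0. *)
suff S_harm d : (d <= n.+1)%N -> S (n.+1 - d)%N = harm n.+1 - harm (n.+1 - d).
  by have := S_harm (n - a)%N; rewrite -subSS subKn //; apply; lia.
elim: d => [_ | d IHd lt_dn].
  rewrite subn0 subrr; apply: big1 => k _.
  by rewrite subnn bin_small // mul0r.
have E : (n.+1 - d = (n.+1 - d.+1).+1)%N by lia.
have := IHd (ltnW lt_dn); rewrite E (harmS (n.+1 - d.+1)) => IH.
by rewrite S_step ?IH; [ring | lia].
Qed.

Section DiscreteConcavity.

Variable f : nat -> rat.
Hypothesis concave_f : forall k, f k.+2 - f k.+1 <= f k.+1 - f k.

Lemma concave_slope (i j : nat) : (i <= j)%N -> f j.+1 - f j <= f i.+1 - f i.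
Proof.
elim: j => [|j IHj]; first by rewrite leqn0 => /eqP->.
rewrite leq_eqVlt => /orP[/eqP-> // | lt_ij].
exact: le_trans (concave_f j) (IHj lt_ij).
Qed.

(** Increments to the right of [q] are at most the slope of this line, those to the left at least
    that slope. *)
Lemma concave_tangent (q x : nat) :
  f x <= f q + (x%:R - q%:R) * (f q.+1 - f q).
Proof.
have [le_qx | /ltnW le_xq] := leqP q x.
  rewrite -(subnKC le_qx); elim: (x - q)%N => [|d IHd].
    by rewrite addn0 subrr mul0r addr0.
  have := concave_slope (leq_addr d q).
  by move: IHd; rewrite addnS -natr1; lra.
rewrite -(subKn le_xq); elim: (q - x)%N (leq_subr x q) => [_|d IHd lt_dq].
  by rewrite subn0 subrr mul0r addr0.
have E : (q - d = (q - d.+1).+1)%N by lia.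
have := concave_slope (leq_subr d.+1 q).
by move: (IHd (ltnW lt_dq)); rewrite E -natr1; lra.
Qed.

(** Weight the tangent bounds at [x], evaluated at [i] and [j], by [j - x] and [x - i]: the slope
    terms cancel. *)
Lemma concave_chord (i x j : nat) : (i <= x <= j)%N ->
  (j%:R - x%:R) * f i + (x%:R - i%:R) * f j <= (j%:R - i%:R) * f x.
Proof.
move=> /andP[le_ix le_xj].
have /ler_wpM2l/(_ _ _ (concave_tangent x i)) : 0 <= j%:R - x%:R :> rat.
  by rewrite subr_ge0 ler_nat.
have /ler_wpM2l/(_ _ _ (concave_tangent x j)) : 0 <= x%:R - i%:R :> rat.
  by rewrite subr_ge0 ler_nat.
by lra.
Qed.

End DiscreteConcavity.

(** Closed form of [x * F3 n x] for [0 < x <= n], extended to all of [nat] so that concavity can be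
    stated there without bounds. *)
Definition part_cost (n x : nat) : rat := x%:R * (harm n - harm x) + 1.

Lemma part_costE (n x : nat) : (0 < x <= n)%N -> x%:R * F3 n x = part_cost n x.
Proof.
move=> /[dup]/andP[x_gt0 _] /F3E->.
by rewrite mulrDr divff // pnatr_eq0 -lt0n.
Qed.

Lemma part_cost_step (n x : nat) :
  part_cost n x.+1 - part_cost n x = harm n - harm x - 1.
Proof.
rewrite /part_cost harmS -natr1; field.
by rewrite natr1 pnatr_eq0.
Qed.

Lemma part_cost_concave (n k : nat) :
  part_cost n k.+2 - part_cost n k.+1 <= part_cost n k.+1 - part_cost n k.
Proof.
rewrite !part_cost_step harmS.
have : 0 <= (k.+1%:R)^-1 :> rat by rewrite invr_ge0 ler0n.
by move: (_^-1) => y; lra.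
Qed.

(** The other [m - 1] parts are each at least 1, which leaves at most [n - m + 1] for [x]. *)
Lemma int_partition_part (n m : nat) (a : seq nat) (x : nat) :
  int_partition n m a -> x \in a -> (0 < x <= n - m + 1)%N.
Proof.
move=> /and3P[/eqP<- /allP a_gt0 /eqP<-] xa; rewrite a_gt0 //=.
have le_size s : all (fun y => 0 < y)%N s -> (size s <= sumn s)%N.
  by elim: s => //= y s IHs /andP[y_gt0 /IHs]; lia.
have a_perm := perm_to_rem xa.
have /allP/le_size : {in rem x a, forall y, (0 < y)%N}.
  by move=> y /mem_rem; apply: a_gt0.
have -> : sumn a = (x + sumn (rem x a))%N by rewrite (perm_sumn a_perm).
by rewrite (perm_size a_perm) /=; lia.
Qed.

Lemma cost3E (n m : nat) (a : seq nat) : (0 < m <= n)%N ->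
  int_partition n m a -> cost3 n a = \sum_(x <- a) part_cost n x.
Proof.
move=> /andP[m_gt0 le_mn] Pa; apply: eq_big_seq => x xa.
by rewrite part_costE //; have := int_partition_part Pa xa; lia.
Qed.

Lemma sum_affine_partition (n m : nat) (a : seq nat) (c d : rat) :
  int_partition n m a ->
  \sum_(x <- a) (c + x%:R * d) = m%:R * c + n%:R * d.
Proof.
move=> /and3P[/eqP<- _ /eqP<-].
rewrite big_split /= big_const_seq count_predT iter_addr_0 mulr_natl.
by rewrite -mulr_suml -natr_sum sumnE.
Qed.

(** Optimality certificate: an affine minorant, on the range of possible parts, that is exact at the
    parts of [a]. *)
Lemma minimal3_affine (n m : nat) (a : seq nat) (c d : rat) :
  (0 < m <= n)%N -> int_partition n m a ->
  (forall x, (0 < x <= n - m + 1)%N -> c + x%:R * d <= part_cost n x) ->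
  {in a, forall x, part_cost n x = c + x%:R * d} -> minimal3 n m a.
Proof.
move=> mn Pa le_cost eq_cost; split=> // b Pb.
rewrite !(cost3E mn) // (eq_big_seq _ eq_cost).
rewrite (sum_affine_partition c d Pa) -(sum_affine_partition c d Pb).
rewrite !big_seq; apply: ler_sum => x /(int_partition_part Pb).
exact: le_cost.
Qed.

Lemma maximal3_affine (n m : nat) (a : seq nat) (c d : rat) :
  (0 < m <= n)%N -> int_partition n m a ->
  (forall x, part_cost n x <= c + x%:R * d) ->
  {in a, forall x, part_cost n x = c + x%:R * d} -> maximal3 n m a.
Proof.
move=> mn Pa cost_le eq_cost; split=> // b Pb.
rewrite !(cost3E mn) // (eq_big_seq _ eq_cost).
rewrite (sum_affine_partition c d Pa) -(sum_affine_partition c d Pb).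
by apply: ler_sum => x _; apply: cost_le.
Qed.

Lemma of_form2_mem (a : seq nat) (u v k l x : nat) :
  of_form a [:: (u, k); (v, l)] -> x \in a -> x = u \/ x = v.
Proof.
move=> /perm_mem-> ; rewrite /tally_seq /= cats0 mem_cat !mem_nseq.
by case/orP=> /andP[_ /eqP->]; [left | right].
Qed.

Theorem theorem3 (n m : nat) (hm : (2 <= m)%N) (hmn : (m < n)%N) :
  (forall a : seq nat,
     int_partition n m a ->
     of_form a [:: (1%N, (m - 1)%N); ((n - m + 1)%N, 1%N)] ->
     minimal3 n m a) /\
  (forall (q r : nat) (a : seq nat),
     n = (q * m + r)%N -> (r < m)%N ->
     int_partition n m a ->
     of_form a [:: (q, (m - r)%N); ((q + 1)%N, r)] ->
     maximal3 n m a).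
Proof.
have mn : (0 < m <= n)%N by lia.
have cost_concave := part_cost_concave n.
split=> [a Pa fa | q r a _ _ Pa fa].
- set M := (n - m + 1)%N in fa *.
  have M_gt1 : 0 < M%:R - 1 :> rat by rewrite subr_gt0 ltr1n /M; lia.
  have M0 : M%:R - 1 != 0 :> rat by rewrite gt_eqF.
  (* Slope of the chord from 1 to [M]; [M > 1] because [m < n]. *)
  pose d := (part_cost n M - part_cost n 1) / (M%:R - 1).
  apply: (@minimal3_affine _ _ _ (part_cost n 1 - d) d) => // [x | x xa].
    rewrite -/M => xM; rewrite -(ler_pM2l M_gt1).
    apply: le_trans (concave_chord cost_concave xM).
    by rewrite le_eqVlt; apply/predU1P; left; rewrite /d; field.
  by case: (of_form2_mem fa xa) => ->; rewrite /d -/M; field.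
(* With the forward difference as slope, the line meets the cost at both [q] and [q.+1], the only
   possible part sizes. *)
- pose d := part_cost n q.+1 - part_cost n q.
  apply: (@maximal3_affine _ _ _ (part_cost n q - q%:R * d) d) => // [x | x xa].
    by have := concave_tangent cost_concave q x; rewrite -/d; lra.
  by case: (of_form2_mem fa xa) => ->; rewrite ?addn1 -?natr1 /d; ring.
Qed.
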